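(* Let $n\ge 1$ be an integer, and let $p,\alpha,\lambda$ be real numbers such that either ($p>1$ and $0<\alpha<\frac{n+2}{2p}$) or ($p=1$ and $0<\alpha\le\frac{n+2}{2p}$), and such that $0<\lambda<1$. Then there exist $N>0$ and $u\in Y^p_\alpha$ satisfying $$0\le(\partial_t-\Delta)^\alpha u\le u^\lambda\quad\text{in }\mathbb{R}^n\times\mathbb{R},\qquad u=0\quad\text{in }\mathbb{R}^n\times(-\infty,0)$$ such that $$u(x,t)\ge(Nt^\alpha)^{\frac{1}{1-\lambda}}\quad\text{for }(x,t)\in\Omega$$ and $$(\partial_t-\Delta)^\alpha u(x,t)\ge(Nt^\alpha)^{\frac{\lambda}{1-\lambda}}\quad\text{for }(x,t)\in\Omega,$$ where $\Omega=\{(x,t)\in\mathbb{R}^n\times\mathbb{R}:|x|^2<t\}$.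
   Context: For $\alpha>0$ and $(x,t)\in\mathbb{R}^n\times\mathbb{R}$ let $$\Phi_\alpha(x,t)=\frac{t^{\alpha-1}}{\Gamma(\alpha)}\frac{1}{(4\pi t)^{n/2}}e^{-|x|^2/(4t)}\chi_{(0,\infty)}(t)$$ and $$J_\alpha f(x,t)=\iint_{\mathbb{R}^n\times(-\infty,t)}\Phi_\alpha(x-\xi,t-\tau)f(\xi,\tau)\,d\xi\,d\tau .$$ For $T\in\mathbb{R}$ put $\mathbb{R}_T=(-\infty,T)$. $X^p=\bigcap_{T\in\mathbb{R}}L^p(\mathbb{R}^n\times\mathbb{R}_T)$ is the set of all measurable $f:\mathbb{R}^n\times\mathbb{R}\to\mathbb{R}$ with $\|f\|_{L^p(\mathbb{R}^n\times\mathbb{R}_T)}<\infty$ for all $T\in\mathbb{R}$, and $Y^p_\alpha=J_\alpha(X^p)$. Functions equal almost everywhere are identified, and (in)equalities between elements of these spaces are understood almost everywhere. When ($p>1$ and $0<\alpha<\frac{n+2}{2p}$) or ($p=1$ and $0<\alpha\le\frac{n+2}{2p}$), the integral defining $J_\alpha f$ yields a real-valued measurable function for each $f\in X^p$, the operator $J_\alpha:X^p\to Y^p_\alpha$ is one-to-one and onto, and $(\partial_t-\Delta)^\alpha:Y^p_\alpha\to X^p$ is defined to be its inverse. Since $(\partial_t-\Delta)^\alpha u\ge0$ forces $u\ge0$, the power $u^\lambda$ is meaningful. *)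

(* Defs.v *)
From HB Require Import structures.
From mathcomp Require Import all_boot all_order all_algebra.
From mathcomp Require Import all_classical all_reals all_analysis.

Set Implicit Arguments.
Unset Strict Implicit.
Unset Printing Implicit Defensive.

Import Order.TTheory GRing.Theory Num.Theory.
Import numFieldNormedType.Exports.

Local Open Scope classical_set_scope.
Local Open Scope ring_scope.

Notation rvec R n := (n.-tuple (measurableTypeR R)).
Notation spacetime R n := (rvec R n * measurableTypeR R)%type.

Section cons_measure.
Context {R : realType} {n : nat}.
Let T := rvec R n.
Let T' := rvec R n.+1.
Variable m : {sigma_finite_measure set T -> \bar R}.

Definition cons_pair (z : measurableTypeR R * T) : T' :=
  [tuple of z.1 :: z.2].

Lemma measurable_cons_pair : measurable_fun setT cons_pair.
Proof. exact: (measurable_cons measurable_fst measurable_snd). Qed.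

HB.instance Definition _ :=
  isMeasurableFun.Build _ _ _ _ cons_pair measurable_cons_pair.

Definition cons_measure : set T' -> \bar R :=
  pushforward (lebesgue_measure \x m)%E cons_pair.

Let cons_measure0 : cons_measure set0 = 0%E.
Proof. exact: measure0. Qed.

Let cons_measure_ge0 A : (0 <= cons_measure A)%E.
Proof. exact: measure_ge0. Qed.

Let cons_measure_sigma_additive : semi_sigma_additive cons_measure.
Proof. exact: measure_semi_sigma_additive. Qed.

HB.instance Definition _ := isMeasure.Build _ _ _ cons_measure
  cons_measure0 cons_measure_ge0 cons_measure_sigma_additive.

Let cons_measure_sigma_finite : sigma_finite setT cons_measure.
Proof.
have /sigma_finiteP[F [TF ndF Foo]] := sigma_finiteT (@lebesgue_measure R).
have /sigma_finiteP[G [TG ndG Goo]] := sigma_finiteT m.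
pose uncons (x : T') : measurableTypeR R * T := (thead x, [tuple of behead x]).
have consK z : uncons (cons_pair z) = z.
  by case: z => a v; congr pair; exact/val_inj.
exists (fun k => uncons @^-1` (F k `*` G k)) => [|k].
  apply/esym/seteqP; split=> // x _.
  have [i _ Fi] : (\bigcup_i F i) (thead x) by rewrite -TF.
  have [j _ Gj] : (\bigcup_i G i) [tuple of behead x] by rewrite -TG.
  exists (maxn i j) => //; split.
    by move: Fi; exact/subsetPset/ndF/leq_maxl.
  by move: Gj; exact/subsetPset/ndG/leq_maxr.
have [mFk Fk] := Foo k; have [mGk Gk] := Goo k; split.
  rewrite -[X in measurable X]setTI.
have: measurable_fun setT uncons.
    apply: measurable_fun_pair.
      exact: (measurable_tnth ord0).
    exact: measurable_behead.
  by apply => //; exact: measurableX.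
have consuncons (X : set (measurableTypeR R * T)%type) :
    cons_pair @^-1` (uncons @^-1` X) = X.
  by apply/funext => z; rewrite /preimage /mkset consK.
rewrite /cons_measure /pushforward consuncons.
by rewrite product_measure1E// lte_mul_pinfty// ge0_fin_numE.
Qed.

HB.instance Definition _ := Measure_isSigmaFinite.Build _ _ _ cons_measure
  cons_measure_sigma_finite.

End cons_measure.

(* The library has no Lebesgue measure on R^n; it is built here as the n-fold
   product of the one on R, with R^n.+1 identified with R * R^n. *)
Fixpoint lebesgue_rvec (R : realType) (n : nat) :
    {sigma_finite_measure set (rvec R n) -> \bar R} :=
  match n with
  | 0 => \d_([tuple] : rvec R 0)
  | n'.+1 => cons_measure (lebesgue_rvec R n')
  end.

Section heat.
Context {R : realType} {n : nat}.
Implicit Types (p alpha t : R) (x : rvec R n) (z w : spacetime R n).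
Implicit Types f u : spacetime R n -> R.

Definition lebesgue_spacetime : {measure set (spacetime R n) -> \bar R} :=
  (lebesgue_rvec R n \x @lebesgue_measure R)%E.

Definition sub_rvec x y : rvec R n :=
  [tuple (tnth x i : R) - (tnth y i : R) | i < n].

Definition sqnorm x : R := \sum_(i < n) (tnth x i : R) ^+ 2.

Definition Gamma alpha : R :=
  \int[@lebesgue_measure R]_(s in `]0, +oo[) (s `^ (alpha - 1) * expR (- s)).

Definition heat_kernel alpha x t : R :=
  t `^ (alpha - 1) / Gamma alpha * ((4 * pi * t) `^ (n%:R / 2))^-1 *
  expR (- sqnorm x / (4 * t)) * \1_(`]0, +oo[) t.

Definition before (T : R) : set (spacetime R n) := [set w | (w.2 : R) < T].

(* The operator J_alpha.  It is extended-real valued, so that an equation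
   (u z)%:E = heat_potential alpha f z also says that the integral converges
   absolutely at z: for a measurable integrand the library's integral is
   infinite otherwise. *)
Definition heat_potential alpha f z : \bar R :=
  (\int[lebesgue_spacetime]_(w in before z.2)
    (heat_kernel alpha (sub_rvec z.1 w.1) ((z.2 : R) - w.2)%R * f w)%:E)%E.

(* Borel functions: every Lebesgue measurable function agrees almost everywhere
   with one of these. *)
Definition Xspace p f : Prop :=
  measurable_fun setT f /\
  forall T : R, finite_norm lebesgue_spacetime p%:E (f \_ (before T)).

(* Yspace is the image of Xspace under J_alpha, functions being taken up to
   equality almost everywhere. *)
Definition Yspace p alpha u : Prop :=
  exists f, Xspace p f /\
    {ae lebesgue_spacetime, forall z, (u z)%:E = heat_potential alpha f z}.

(* The graph of the inverse of J_alpha : Xspace -> Yspace: f is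
   (d/dt - Laplacian)^alpha u.  As J_alpha is one-to-one, u determines f up to
   equality almost everywhere. *)
Definition frac_heat p alpha u f : Prop :=
  Xspace p f /\
  {ae lebesgue_spacetime, forall z, (u z)%:E = heat_potential alpha f z}.

Definition Omega : set (spacetime R n) := [set z | sqnorm z.1 < z.2].

End heat.

(* Main.v *)
Require Import Defs.
From mathcomp Require Import all_boot all_order all_algebra.
From mathcomp Require Import all_classical all_reals all_analysis.
From mathcomp Require Import measurable_realfun ring lra.
Import Order.TTheory GRing.Theory Num.Theory.
Import numFieldNormedType.Exports.
Local Open Scope classical_set_scope.
Local Open Scope ring_scope.
Set Implicit Arguments.
Unset Strict Implicit.
Unset Printing Implicit Defensive.

(** The solution is the potential u = J_alpha f of an explicit source carried
by the paraboloid Omega,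
  f (x, t) = (N t^alpha)^(lambda / (1 - lambda)) on Omega, and 0 elsewhere.
The exponent is dictated by parabolic scaling: Omega is invariant under
(x, t) -> (r x, r^2 t), the kernel Phi_alpha is homogeneous under it, and
J_alpha gains the factor t^alpha, so that in Omega
  J_alpha f >= N t^alpha (N t^alpha)^(lambda / (1 - lambda))
             = (N t^alpha)^(1 / (1 - lambda))
as soon as N is small enough.  The power lambda of the right-hand side is f, so
f <= u^lambda in Omega; outside Omega this says 0 <= u^lambda.  The potential
vanishes at negative times because the source does.

The lower bound is heat_potential_parabolic_ge: only the part of the source in a
box of size comparable to that of the past of (x, t) in Omega is kept, where the
kernel is bounded below by its scaling.  The source at times between t / 2 and t
is at least its value at t / 2, and power_profile_half fixes N accordingly.

For u to be a genuine potential the integral has to converge, which is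
heat_potential_fin_num: f is bounded before each time, the Gaussian has total
mass 1 in space, and t^(alpha - 1) is integrable at 0.  The same integrability
gives Gamma_gt0, without which the kernel would degenerate to 0.  Finally f is
in X^p by Xspace_supported_Omega since Omega is bounded before each time. *)

(** * Power singularities in time and the Gamma integral *)

(** The fundamental theorem of calculus holds on the compact intervals
[a + e_k, b - e_k], where f is continuous, and monotone convergence passes to
their union.  The antiderivative needs no limits at a and b, only bounded
oscillation, so integrands with an endpoint singularity are covered. *)
Lemma integral_itvoo_le_antiderivative (R : realType) (f F : R -> R)
    (a b C : R) :
  measurable_fun setT f ->
  {in `]a, b[, forall s, 0 <= f s} ->
  {in `]a, b[, continuous f} ->
  {in `]a, b[, forall s : R, is_derive s 1 F (f s)} ->
  0 <= C ->
  {in `]a, b[ &, forall c d : R, F d - F c <= C} ->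
  (\int[lebesgue_measure]_(s in `]a, b[) (f s)%:E <= C%:E)%E.
Proof.
move=> mf f0 cf dF C0 FC.
pose e (k : nat) : R := k.+1%:R^-1.
have e0 k : 0 < e k by rewrite invr_gt0.
have subab k : [set` `[a + e k, b - e k]] `<=` [set` `]a, b[].
  move=> s /=; rewrite !in_itv/= => /andP[as_ sb].
  by rewrite (lt_le_trans _ as_) ?ltrDl// (le_lt_trans sb)// gtrDl oppr_lt0.
have -> : [set` `]a, b[] = \bigcup_k [set` `[a + e k, b - e k]].
  apply/seteqP; split=> [s|s [k _]]; last exact: subab.
  rewrite /= in_itv/= => /andP[as_ sb].
  have [k ke] : exists k, e k < Num.min (s - a) (b - s).
    have m0 : 0 < Num.min (s - a) (b - s) by rewrite lt_min !subr_gt0 as_.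
    exists (Num.truncn (Num.min (s - a) (b - s))^-1).
    by rewrite invf_plt ?posrE// truncnS_gt.
  exists k => //=; move: ke; rewrite lt_min in_itv/= => /andP[k1 k2].
  by rewrite -lerBrDl ltW//= lerBrDr -lerBrDl ltW.
have ndI : nondecreasing_seq (fun k => [set` `[a + e k, b - e k]]).
  move=> i j ij; rewrite subsetEset => s /=; rewrite !in_itv/=.
  have eji : e j <= e i by rewrite lef_pV2 ?posrE// ler_nat.
  by move=> /andP[? ?]; apply/andP; split; lra.
have cvgI : (\int[lebesgue_measure]_(s in [set` `[(a + e k)%R, (b - e k)%R]])
    (f s)%:E)%E @[k --> \oo] -->
    (\int[lebesgue_measure]_(s in \bigcup_k [set` `[(a + e k)%R, (b - e k)%R]])
      (f s)%:E)%E.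
  apply: ge0_nondecreasing_set_cvg_integral => //.
    by move=> k; apply/measurable_EFinP; exact: measurable_funS mf.
  by move=> k s /subab sab; rewrite lee_fin f0.
rewrite -(cvg_lim _ cvgI)//; apply: lime_le; first by apply: cvgP cvgI.
apply: nearW => k.
have [ab|] := ltP (a + e k) (b - e k); last first.
  rewrite le_eqVlt => /orP[/eqP->|ba].
    by rewrite set_itv1 integral_set1 lee_fin.
  by rewrite set_itv_ge ?integral_set0 ?lee_fin// bnd_simp -ltNge.
have dF' s : s \in `[a + e k, b - e k] -> derivable F s 1.
  by move=> /subab sab; have [] := dF s sab.
rewrite (@continuous_FTC2 _ f F)//.
- rewrite lee_fin; apply: FC; apply: (subab k).
    by rewrite /= in_itv/= (ltW ab) lexx.
  by rewrite /= in_itv/= lexx (ltW ab).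
- apply: continuous_in_subspaceT => s; rewrite inE => /subab; exact: cf.
- split.
  + by move=> s /subset_itv_oo_cc; exact: dF'.
  + apply: cvg_at_right_filter; apply: differentiable_continuous.
    by apply/derivable1_diffP/dF'; rewrite in_itv/= lexx ltW.
  + apply: cvg_at_left_filter; apply: differentiable_continuous.
    by apply/derivable1_diffP/dF'; rewrite in_itv/= lexx ltW.
- move=> s /subset_itv_oo_cc /subab /dF sab.
  by rewrite derive1E; apply: derive_val.
Qed.

Lemma is_derive_subl (R : realType) (t s : R) :
  is_derive s 1 (fun s : R => t - s) (-1).
Proof.
by rewrite -[-1]add0r; apply: is_deriveB.
Qed.

Lemma is_derive_powR_subl (R : realType) (b t s : R) : s < t ->
  is_derive s 1 (fun s => (t - s) `^ b) (- (b * (t - s) `^ (b - 1))).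
Proof.
move=> st; have ts : 0 < t - s by rewrite subr_gt0.
apply: (is_derive_eq (f' := b * (t - s) `^ (b - 1) * -1)); last exact: mulrN1.
exact: (@is_derive1_comp _ (fun x => x `^ b) (fun s => t - s) s _ _
  (is_derive1_powR b ts) (is_derive_subl t s)).
Qed.

(** The time singularity of the heat kernel is integrable precisely because
a > 0: the antiderivative - (t - s)^a / a stays bounded up to s = t. *)
Lemma integral_powR_end_le (R : realType) (a t : R) : 0 < a -> 0 < t ->
  (\int[lebesgue_measure]_(s in `]0%R, t[) ((t - s) `^ (a - 1))%:E
   <= (t `^ a / a)%:E)%E.
Proof.
move=> a0 t0.
apply: (@integral_itvoo_le_antiderivative _ (fun s => (t - s) `^ (a - 1))
  (fun s => - a^-1 *: (t - s) `^ a)).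
- apply: (@measurableT_comp _ _ _ _ _ _ (@powR R ^~ (a - 1))).
    exact: measurable_powR.
  exact: measurable_funB.
- by move=> s _; exact: powR_ge0.
- move=> s; rewrite in_itv/= => /andP[_ st].
  apply: differentiable_continuous; apply/derivable1_diffP.
  by have [] := is_derive_powR_subl (a - 1) st.
- move=> s; rewrite in_itv/= => /andP[_ st].
  apply: (is_derive_eq (f' := - a^-1 *: - (a * (t - s) `^ (a - 1)))).
    exact: (@is_deriveZ _ _ _ _ (- a^-1) _ _ _ (is_derive_powR_subl a st)).
  by rewrite /GRing.scale/= mulrNN mulrA mulVf ?mul1r// gt_eqF.
- by rewrite divr_ge0 ?powR_ge0 ?ltW.
- move=> c d; rewrite !in_itv/= => /andP[c0 ct] /andP[d0 dt].
  rewrite -scalerBr /GRing.scale/= mulNr -mulrN opprB mulrC ler_wpM2r ?invr_ge0 ?(ltW a0)//.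
  rewrite lerBlDr (@le_trans _ _ (t `^ a))//.
    rewrite ge0_ler_powR ?nnegrE ?(ltW a0) ?(ltW t0) ?subr_ge0 ?(ltW ct)//.
    by rewrite gerBl ltW.
  by rewrite lerDl powR_ge0.
Qed.

Lemma integral_powR_start_le (R : realType) (a : R) : 0 < a ->
  (\int[lebesgue_measure]_(s in `]0%R, 1%R[) (s `^ (a - 1))%:E
   <= (a^-1)%:E)%E.
Proof.
move=> a0.
apply: (@integral_itvoo_le_antiderivative _ (fun s => s `^ (a - 1)) (fun s => a^-1 *: s `^ a)).
- exact: measurable_powR.
- by move=> s _; exact: powR_ge0.
- move=> s; rewrite in_itv/= => /andP[s0 _].
  apply: differentiable_continuous; apply/derivable1_diffP.
  by have [] := is_derive1_powR (a - 1) s0.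
- move=> s; rewrite in_itv/= => /andP[s0 _].
  apply: (is_derive_eq (f' := a^-1 *: (a * s `^ (a - 1)))).
    exact: (@is_deriveZ _ _ _ _ a^-1 _ _ _ (is_derive1_powR a s0)).
  by rewrite /GRing.scale/= mulrA mulVf ?mul1r// gt_eqF.
- by rewrite invr_ge0 ltW.
- move=> c d; rewrite !in_itv/= => /andP[c0 c1] /andP[d0 d1].
  rewrite -scalerBr /GRing.scale/= ler_piMr ?invr_ge0 ?(ltW a0)//.
  rewrite lerBlDr (@le_trans _ _ 1)//; last by rewrite lerDl powR_ge0.
  suff : d `^ a <= 1 `^ a by rewrite powR1.
  by rewrite ge0_ler_powR ?nnegrE ?(ltW a0) ?(ltW d0) ?(ltW d1).
Qed.

(** The exponential absorbs the power: raising s / (2 a) <= exp (s / (2 a)) to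
the power a gives s^a <= (2 a)^a exp (s / 2). *)
Lemma Gamma_integrand_decay (R : realType) (a : R) : 0 < a ->
  exists2 C : R, 0 <= C &
    forall s, 1 <= s -> s `^ (a - 1) * expR (- s) <= C * expR (- (s / 2)).
Proof.
move=> a0; exists ((2 * a) `^ a); first exact: powR_ge0.
move=> s s1; have s0 : 0 <= s by lra.
have -> : - s = s / 2 + (- s) - s / 2 by field.
rewrite expRD mulrA ler_wpM2r ?expR_ge0//.
have -> : s / 2 - s = - (s / 2) by field.
rewrite expRN ler_pdivrMr ?expR_gt0//.
apply: (@le_trans _ _ (s `^ a)); first by rewrite ler_powR// lerBlDr lerDl.
have a2 : 0 < 2 * a by rewrite mulr_gt0.
have sE : s <= 2 * a * expR (s / (2 * a)).
  rewrite -ler_pdivrMl// mulrC; apply: le_trans (expR_ge1Dx _).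
  by rewrite lerDr.
have -> : expR (s / 2) = expR (s / (2 * a)) `^ a.
  by rewrite -expRM; congr expR; field; rewrite gt_eqF.
rewrite -powRM ?expR_ge0 ?(ltW a2)//.
by apply: ge0_ler_powR; rewrite ?nnegrE ?(ltW a0)// (le_trans s0).
Qed.

(** Gamma a is the finite part of an extended-real integral, hence 0 if that
integral diverges; so convergence is part of this positivity.  Near 0 the
integrand is at most s^(a - 1), beyond 1 it is dominated by an exponential
density, and on [1, 2] it is bounded below. *)
Lemma Gamma_gt0 (R : realType) (a : R) : 0 < a -> 0 < Gamma a.
Proof.
move=> a0; pose g (s : R) := s `^ (a - 1) * expR (- s).
have g0 s : 0 <= g s by rewrite mulr_ge0 ?powR_ge0 ?expR_ge0.
have mg : measurable_fun setT (EFin \o g).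
  apply/measurable_EFinP/measurable_funM; first exact: measurable_powR.
  exact: measurableT_comp.
have mgD (D : set (measurableTypeR R)) : measurable_fun D (EFin \o g).
  exact: measurable_funS mg.
rewrite /Gamma /Rintegral; apply: fine_gt0; apply/andP; split.
  apply: (@lt_le_trans _ _
    (\int[@lebesgue_measure R]_(s in `[1%R, 2%R]) (expR (- 2) / 2)%:E)%E).
    rewrite integral_cst//= lebesgue_measure_itv/= lte_fin ltr1n -EFinB -EFinM.
    by rewrite lte_fin mulr_gt0 ?divr_gt0 ?expR_gt0// subr_gt0 ltr1n.
  apply: (@le_trans _ _ (\int[@lebesgue_measure R]_(s in `[1%R, 2%R]) (g s)%:E)%E).
    apply: ge0_le_integral => //= s; rewrite in_itv/= => /andP[s1 s2].
    rewrite lee_fin /g mulrC ler_pM ?invr_ge0 ?expR_ge0 ?ler_expR ?lerN2//.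
    (* a - 1 >= -1 gives s^(a - 1) >= 1 / s >= 1 / 2, whatever the sign of
       a - 1. *)
    apply: (@le_trans _ _ (s `^ (- 1))); last by rewrite ler_powR//; lra.
    by rewrite powR_inv1; [rewrite lef_pV2 ?posrE//; lra|lra].
  apply: ge0_subset_integral => //=.
  - by move=> s _; rewrite lee_fin g0.
  - by move=> s /=; rewrite !in_itv/= andbT => /andP[s1 _]; lra.
have [C C0 gC] := Gamma_integrand_decay a0.
have -> : [set` `]0%R, +oo[] = [set` `]0%R, 1%R[] `|` [set` `[1%R, +oo[] :> set R.
  by rewrite -itv_bndbnd_setU ?bnd_simp.
rewrite ge0_integral_setU//=; last 2 first.
- by move=> s _; rewrite lee_fin g0.
- by apply: lt_disjoint => x y; rewrite !in_itv/= andbT => /andP[_ x1] /(lt_le_trans x1).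
apply: lte_add_pinfty.
  apply: (le_lt_trans _ (ltry a^-1)).
  apply: le_trans (integral_powR_start_le a0).
  apply: ge0_le_integral => //=.
  - by move=> s _; rewrite lee_fin g0.
  - by apply/measurable_EFinP; apply: measurable_funTS; exact: measurable_powR.
  - move=> s; rewrite in_itv/= => /andP[s0 _]; rewrite lee_fin /g.
    rewrite ler_piMr ?powR_ge0// -[leRHS]expR0 ler_expR oppr_le0 ltW//.
apply: (@le_lt_trans _ _ ((2 * C)%:E * 1)%E); last by rewrite mule1 ltry.
have h0 : 0 < 2^-1 :> R by rewrite invr_gt0.
rewrite -(integral_exponential_pdf h0) -ge0_integralZl_EFin//=; last 3 first.
- by move=> s _; rewrite lee_fin exponential_pdf_ge0// ltW.
- by apply/measurable_EFinP; exact: measurable_exponential_pdf.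
- by rewrite mulr_ge0.
have mE : measurable_fun setT (fun s : R => ((2 * C)%:E * (exponential_pdf 2^-1 s)%:E)%E).
  under eq_fun do rewrite -EFinM.
  by apply/measurable_EFinP/measurable_funM => //; exact: measurable_exponential_pdf.
apply: (@le_trans _ _ (\int[@lebesgue_measure R]_(s in `[1%R, +oo[)
    ((2 * C)%:E * (exponential_pdf 2^-1 s)%:E))%E).
  apply: ge0_le_integral => //=.
  - by move=> s _; rewrite lee_fin g0.
  - exact: measurable_funS mE.
  - move=> s; rewrite in_itv/= andbT => s1; rewrite -EFinM lee_fin.
    apply: le_trans (gC s s1) _.
    rewrite /exponential_pdf patchE mem_set/=; last by rewrite in_itv/= andbT; lra.
    have -> : - 2^-1 * s = - (s / 2) by rewrite mulNr mulrC.
    by rewrite mulrACA mulfV// mul1r.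
apply: ge0_subset_integral => //= s _.
by rewrite mule_ge0// lee_fin ?exponential_pdf_ge0 ?mulr_ge0// ltW.
Qed.

(** * Integrals of products over R^n *)

Lemma measurable_prod_tnth (R : realType) (n : nat) (g : 'I_n -> R -> R) :
  (forall i, measurable_fun setT (g i)) ->
  measurable_fun setT (fun x : rvec R n => \prod_(i < n) g i (tnth x i)).
Proof.
move=> mg; apply: measurable_prod => i _.
exact: (measurableT_comp (mg i) (measurable_tnth i)).
Qed.

(** Tonelli, by induction on the dimension: R^(n+1) carries the image of the
product of the measures on R and R^n. *)
Lemma integral_lebesgue_rvec_prod (R : realType) (n : nat) (g : 'I_n -> R -> R)
    (c : 'I_n -> R) :
  (forall i, measurable_fun setT (g i)) ->
  (forall i s, 0 <= g i s) ->
  (forall i, (\int[lebesgue_measure]_s (g i s)%:E = (c i)%:E)%E) ->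
  (\int[lebesgue_rvec R n]_x (\prod_(i < n) g i (tnth x i))%:E =
   (\prod_(i < n) c i)%:E)%E.
Proof.
elim: n => [|n IHn] in g c *; move=> mg g0 gc.
  under eq_integral do rewrite big_ord0.
  by rewrite integral_dirac// big_ord0 diracE mem_set// mul1e.
have gS : (fun x : rvec R n.+1 => (\prod_(i < n.+1) g i (tnth x i))%:E) \o
      cons_pair =
    fun z : measurableTypeR R * rvec R n =>
      ((g ord0 z.1)%:E * (\prod_(i < n) g (lift ord0 i) (tnth z.2 i))%:E)%E.
  apply/funext => z /=; rewrite big_ord_recl tnth0 -EFinM; congr (_ * _)%:E.
  by apply: eq_bigr => i _; rewrite tnthS.
have mgS : measurable_fun setT (fun x : rvec R n.+1 =>
    (\prod_(i < n.+1) g i (tnth x i))%:E).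
  by apply/measurable_EFinP; exact: measurable_prod_tnth.
rewrite /= /cons_measure ge0_integral_pushforward//; last first.
  by move=> x _; rewrite lee_fin prodr_ge0.
rewrite gS preimage_setT fubini_tonelli1/=; last 2 first.
- by rewrite -gS; apply: measurableT_comp => //; exact: measurable_cons_pair.
- by move=> z; rewrite mule_ge0// lee_fin// prodr_ge0.
rewrite /fubini_F/=.
under eq_integral => a _.
  rewrite ge0_integralZl_EFin//; last 2 first.
    by move=> x _; rewrite lee_fin prodr_ge0.
    by apply/measurable_EFinP; exact: (measurable_prod_tnth (fun i => mg (lift ord0 i))).
  rewrite (IHn (fun i => g (lift ord0 i)) (fun i => c (lift ord0 i)))//.
  over.
rewrite big_ord_recl EFinM -gc ge0_integralZr//=.
- by apply/measurable_EFinP; exact: mg.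
- by move=> a _; rewrite lee_fin.
- rewrite lee_fin prodr_ge0// => i _; rewrite -lee_fin -gc.
  by apply: integral_ge0 => s _; rewrite lee_fin.
Qed.

Lemma integral_lebesgue_rvec_cube (R : realType) (n : nat) (a b : R) : a <= b ->
  (\int[lebesgue_rvec R n]_x (\prod_(i < n) \1_`[a, b] (tnth x i))%:E =
   ((b - a) ^+ n)%:E)%E.
Proof.
move=> ab.
rewrite (@integral_lebesgue_rvec_prod _ _ (fun=> \1_`[a, b])
  (fun=> b - a))//=.
- by rewrite prodr_const card_ord.
- move=> i; rewrite integral_indic//= setIT lebesgue_measure_itv/= lte_fin.
  have [//|] := ltP a b; rewrite le_eqVlt ltNge ab orbF => /eqP ->.
  by rewrite subrr.
Qed.

(** * The heat kernel *)

Lemma sub_rvecE (R : realType) (n : nat) (x y : rvec R n) i :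
  tnth (sub_rvec x y) i = (tnth x i : R) - tnth y i.
Proof. by rewrite tnth_mktuple. Qed.

Lemma sqnorm_ge0 (R : realType) (n : nat) (x : rvec R n) : 0 <= sqnorm x.
Proof. by apply: sumr_ge0 => i _; exact: sqr_ge0. Qed.

Lemma sqnorm_sub_le (R : realType) (n : nat) (x y : rvec R n) :
  sqnorm (sub_rvec x y) <= 2 * (sqnorm x + sqnorm y).
Proof.
rewrite /sqnorm -big_split/= mulr_sumr; apply: ler_sum => i _.
rewrite sub_rvecE; set a : R := tnth x i; set b : R := tnth y i.
by have := sqr_ge0 (a + b); nra.
Qed.

Lemma measurable_sqnorm_sub (R : realType) (n : nat) (x : rvec R n) :
  measurable_fun setT (fun y : rvec R n => sqnorm (sub_rvec x y)).
Proof.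
rewrite /sqnorm; apply: measurable_sum => i.
under eq_fun do rewrite sub_rvecE.
apply: measurable_funX; apply: measurable_funB => //.
exact: measurable_tnth.
Qed.

Lemma measurable_sqnorm (R : realType) (n : nat) :
  measurable_fun setT (@sqnorm R n).
Proof.
apply: measurable_sum => i; apply: measurable_funX; exact: measurable_tnth.
Qed.

Lemma measurable_before (R : realType) (n : nat) (T : R) :
  measurable (@before R n T).
Proof.
rewrite -[before T]setTI; apply: (@measurable_snd _ _ (rvec R n)
  (measurableTypeR R) measurableT [set` `]-oo, T[]).
exact: measurable_itv.
Qed.

Lemma measurable_Omega (R : realType) (n : nat) : measurable (@Omega R n).
Proof.
have mf : measurable_fun setT (fun z : spacetime R n => (z.2 : R) - sqnorm z.1).
  apply: measurable_funB => //.
  exact: (measurableT_comp (@measurable_sqnorm R n) measurable_fst).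
have -> : @Omega R n =
    setT `&` (fun z : spacetime R n => (z.2 : R) - sqnorm z.1) @^-1`
      [set` `]0, +oo[].
  by rewrite setTI; apply/seteqP; split => z;
    rewrite /Omega /= in_itv/= andbT subr_gt0.
by apply: mf => //; exact: measurable_itv.
Qed.

Lemma heat_kernel_ge0 (R : realType) (n : nat) (a t : R) (x : rvec R n) :
  0 < a -> 0 <= heat_kernel a x t.
Proof.
move=> a0; rewrite /heat_kernel !mulr_ge0 ?expR_ge0 ?powR_ge0//.
- by rewrite invr_ge0 ltW// Gamma_gt0.
- by rewrite invr_ge0 powR_ge0.
Qed.

(** Writing 1 / s as s (s^2)^(-1), with a real power, makes the formula hold
at s = 0 as well and avoids splitting off the discontinuity. *)
Lemma measurable_invr (R : realType) : measurable_fun setT (@GRing.inv R).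
Proof.
have -> : @GRing.inv R = fun s => s * (s ^+ 2) `^ (- 1).
  apply/funext => s; rewrite powR_inv1 ?sqr_ge0//.
  by have [->|s0] := eqVneq s 0; [rewrite invr0 mul0r|field].
apply: measurable_funM => //.
apply: (@measurableT_comp _ _ _ _ _ _ (fun s : R => s `^ (- 1))).
  exact: measurable_powR.
exact: measurable_funX.
Qed.

Lemma measurable_heat_kernel (R : realType) (n : nat) (a t : R) (x : rvec R n) :
  measurable_fun setT (fun w : spacetime R n =>
    heat_kernel a (sub_rvec x w.1) (t - w.2)).
Proof.
have mt : measurable_fun setT (fun w : spacetime R n => t - (w.2 : R)).
  by apply: measurable_funB.
have mpow b (g : spacetime R n -> R) : measurable_fun setT g ->
    measurable_fun setT (fun w => g w `^ b).
  move=> mg; apply: (@measurableT_comp _ _ _ _ _ _ (fun s : R => s `^ b)) mg.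
  exact: measurable_powR.
have m4 (b : R) : measurable_fun setT (fun w : spacetime R n => b * (t - w.2)).
  exact: measurable_funM.
rewrite /heat_kernel; apply: measurable_funM; last first.
  by apply: (@measurableT_comp _ _ _ _ _ _ (\1_`]0, +oo[ : R -> R)) mt.
apply: measurable_funM.
  apply: measurable_funM; first by apply: measurable_funM => //; exact: mpow.
  under eq_fun do rewrite -powRN.
  by apply: mpow; exact: m4.
apply: measurableT_comp => //; apply: measurable_funM.
  apply: measurableT_comp => //.
  exact: (measurableT_comp (measurable_sqnorm_sub x) measurable_fst).
exact: (measurableT_comp (@measurable_invr R) (m4 4)).
Qed.

(** In space the kernel is a product of Gaussian densities centred at the
coordinates of x, of variance 2 s, so that its mass comes from the
normalization of the normal law. *)
Lemma heat_kernel_normal_pdf (R : realType) (n : nat) (a s : R)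
    (x y : rvec R n) : 0 < s ->
  heat_kernel a (sub_rvec x y) s =
  s `^ (a - 1) / Gamma a *
  \prod_(i < n) normal_pdf (tnth x i : R) (Num.sqrt (2 * s)) (tnth y i).
Proof.
move=> s0; have s2 : 0 < 2 * s by rewrite mulr_gt0.
have s4 : 0 <= 4 * pi * s by rewrite !mulr_ge0 ?pi_ge0// ltW.
rewrite /heat_kernel indicE mem_set ?mulr1; last by rewrite /= in_itv/= s0.
rewrite -mulrA; congr (_ * _).
under eq_bigr do rewrite normal_pdfE ?gt_eqF ?sqrtr_gt0//.
rewrite big_split/= prodr_const card_ord; congr (_ * _).
  rewrite /normal_peak sqr_sqrtr ?(ltW s2)// exprVn.
  rewrite [n%:R / 2]mulrC powRrM powR12_sqrt// powR_mulrn ?sqrtr_ge0//.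
  by congr (Num.sqrt _ ^- n); ring.
rewrite /normal_fun -expR_sum; congr expR.
rewrite /sqnorm -sumrN mulr_suml; apply: eq_bigr => i _.
rewrite sub_rvecE sqr_sqrtr ?(ltW s2)//.
set c : R := tnth x i; set d : R := tnth y i.
by field; rewrite gt_eqF.
Qed.

Lemma integral_heat_kernel (R : realType) (n : nat) (a s : R)
    (x : rvec R n) : 0 < a -> 0 < s ->
  (\int[lebesgue_rvec R n]_y (heat_kernel a (sub_rvec x y) s)%:E =
   (s `^ (a - 1) / Gamma a)%:E)%E.
Proof.
move=> a0 s0.
under eq_integral do rewrite heat_kernel_normal_pdf// EFinM.
have mpdf i : measurable_fun setT
    (normal_pdf (tnth x i : R) (Num.sqrt (2 * s))).
  exact: measurable_normal_pdf.
rewrite ge0_integralZl_EFin//.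
- rewrite (integral_lebesgue_rvec_prod (c := fun=> 1)
    (g := fun i => normal_pdf (tnth x i : R) (Num.sqrt (2 * s))))//.
  + by rewrite big1 ?mule1.
  + by move=> i r; exact: normal_pdf_ge0.
  + by move=> i; exact: integral_normal_pdf.
- by move=> y _; rewrite lee_fin prodr_ge0// => i _; exact: normal_pdf_ge0.
- by apply/measurable_EFinP; exact: (measurable_prod_tnth mpdf).
- by rewrite divr_ge0 ?powR_ge0 ?ltW ?Gamma_gt0.
Qed.

(** * Boxes in space-time *)

(** The indicator of [a, b]^n * [r, s] is kept in product form so that its
integral can be computed coordinate by coordinate. *)
Definition spacetime_box (R : realType) (n : nat) (a b r s : R)
    (w : spacetime R n) : R :=
  (\prod_(i < n) \1_`[a, b] (tnth w.1 i : R)) * \1_`[r, s] (w.2 : R).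

Lemma spacetime_box_ge0 (R : realType) (n : nat) (a b r s : R)
    (w : spacetime R n) : 0 <= spacetime_box a b r s w.
Proof. by rewrite mulr_ge0// prodr_ge0. Qed.

Lemma measurable_spacetime_box (R : realType) (n : nat) (a b r s : R) :
  measurable_fun setT (@spacetime_box R n a b r s).
Proof.
have mI (c d : R) : measurable_fun setT (\1_`[c, d] : R -> R).
  exact: measurable_indic.
apply: measurable_funM; last exact: (measurableT_comp (mI r s)).
exact: (measurableT_comp (measurable_prod_tnth (fun=> mI a b)) measurable_fst).
Qed.

Lemma spacetime_box_out (R : realType) (n : nat) (a b r s : R)
    (w : spacetime R n) :
  ~ ((forall i, a <= (tnth w.1 i : R) <= b) /\ r <= (w.2 : R) <= s) ->
  spacetime_box a b r s w = 0.
Proof.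
move=> out; have [box|] := pselect (forall i, a <= (tnth w.1 i : R) <= b).
  rewrite /spacetime_box [\1_ _ _]indicE memNset ?mulr0//= in_itv/= => rs.
  exact: out.
move=> /existsNP[i ai]; rewrite /spacetime_box (bigD1 i)//= indicE memNset.
  by rewrite !mul0r.
by rewrite /= in_itv.
Qed.

Lemma spacetime_box_in (R : realType) (n : nat) (a b r s : R)
    (w : spacetime R n) :
  (forall i, a <= (tnth w.1 i : R) <= b) -> r <= (w.2 : R) <= s ->
  spacetime_box a b r s w = 1.
Proof.
move=> box rs; rewrite /spacetime_box indicE mem_set ?mulr1 /= ?in_itv//.
by rewrite big1// => i _; rewrite indicE mem_set //= in_itv/= box.
Qed.

Lemma integral_spacetime_box (R : realType) (n : nat) (a b r s c : R) :
  a <= b -> r <= s -> 0 <= c ->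
  (\int[lebesgue_spacetime]_w (c * @spacetime_box R n a b r s w)%:E =
   (c * ((b - a) ^+ n * (s - r)))%:E)%E.
Proof.
move=> ab rs c0; have mb := @measurable_spacetime_box R n a b r s.
have mI (d e : R) : measurable_fun setT (\1_`[d, e] : R -> R).
  exact: measurable_indic.
under eq_integral do rewrite EFinM.
rewrite ge0_integralZl_EFin//; last 2 first.
- by move=> w _; rewrite lee_fin spacetime_box_ge0.
- exact/measurable_EFinP.
rewrite EFinM; congr (_ * _)%E.
rewrite /lebesgue_spacetime fubini_tonelli2; last 2 first.
- exact/measurable_EFinP.
- by move=> w; rewrite lee_fin spacetime_box_ge0.
rewrite /fubini_G /spacetime_box/=.
under eq_integral => t _.
  under eq_integral do rewrite EFinM.
  rewrite ge0_integralZr//; last 2 first.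
  - by apply/measurable_EFinP; exact: (measurable_prod_tnth (fun=> mI a b)).
  - by move=> y _; rewrite lee_fin prodr_ge0.
  rewrite integral_lebesgue_rvec_cube//.
  over.
rewrite ge0_integralZl_EFin//=; last 2 first.
- exact/measurable_EFinP.
- by rewrite exprn_ge0// subr_ge0.
rewrite EFinM; congr (_ * _)%E.
rewrite integral_indic//= setIT lebesgue_measure_itv/= lte_fin.
have [//|] := ltP r s; rewrite le_eqVlt ltNge rs orbF => /eqP ->.
by rewrite subrr.
Qed.

(** * Convergence of the potential *)

Lemma heat_potential_integrand_ge0 (R : realType) (n : nat) (a : R)
    (f : spacetime R n -> R) (z w : spacetime R n) :
  0 < a -> (forall w, 0 <= f w) ->
  (0 <= (heat_kernel a (sub_rvec z.1 w.1) ((z.2 : R) - w.2) * f w)%:E)%E.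
Proof. by move=> a0 f0; rewrite lee_fin mulr_ge0// heat_kernel_ge0. Qed.

Lemma measurable_heat_potential_integrand (R : realType) (n : nat) (a : R)
    (f : spacetime R n -> R) (z : spacetime R n) :
  measurable_fun setT f ->
  measurable_fun setT (fun w : spacetime R n =>
    (heat_kernel a (sub_rvec z.1 w.1) ((z.2 : R) - w.2) * f w)%:E).
Proof.
move=> mf; apply/measurable_EFinP/measurable_funM => //.
exact: measurable_heat_kernel.
Qed.

Lemma heat_potential_eq0 (R : realType) (n : nat) (a : R)
    (f : spacetime R n -> R) (z : spacetime R n) :
  (forall w, before z.2 w -> f w = 0) -> heat_potential a f z = 0%E.
Proof.
by move=> f0; rewrite /heat_potential integral0_eq// => w /f0 ->; rewrite mulr0.
Qed.

(** For the source restricted to times in (0, t) and bounded by M, integrating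
the Gaussian first leaves M / Gamma a times the integral of (t - s)^(a - 1),
which is finite. *)
Lemma heat_potential_fin_num (R : realType) (n : nat) (a : R)
    (f : spacetime R n -> R) (z : spacetime R n) (M : R) :
  0 < a -> measurable_fun setT f -> (forall w, 0 <= f w) ->
  (forall w, (w.2 : R) <= 0 -> f w = 0) ->
  (forall w, before z.2 w -> f w <= M) ->
  heat_potential a f z \is a fin_num.
Proof.
move=> a0 mf f0 fneg fM.
have P0 : (0 <= heat_potential a f z)%E.
  by apply: integral_ge0 => w _; exact: heat_potential_integrand_ge0.
rewrite ge0_fin_numE//; case: z fM P0 => [x t] /= fM P0.
have [t0|t0] := leP t 0.
  rewrite heat_potential_eq0// => w /ltW wt; apply: fneg.
  exact: le_trans t0.
have M0 : 0 <= M.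
  by apply: le_trans (f0 _) (fM (x, 0) _).
pose I : R -> R := \1_`]0, t[.
pose h (w : spacetime R n) : R :=
  M * (heat_kernel a (sub_rvec x w.1) (t - w.2) * I w.2).
have mI : measurable_fun setT I by exact: measurable_indic.
have mh : measurable_fun setT (EFin \o h).
  apply/measurable_EFinP; apply: measurable_funM => //.
  apply: measurable_funM; first exact: measurable_heat_kernel.
  exact: (measurableT_comp mI).
have h0 w : (0 <= (h w)%:E)%E.
  by rewrite lee_fin mulr_ge0// mulr_ge0 ?heat_kernel_ge0// /I indicE.
apply: (@le_lt_trans _ _ (\int[lebesgue_spacetime]_w (h w)%:E)%E).
  apply: (@le_trans _ _ (\int[lebesgue_spacetime]_(w in before t) (h w)%:E)%E).
    apply: ge0_le_integral => //.
    - exact: measurable_before.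
    - by move=> w _; exact: (@heat_potential_integrand_ge0 _ _ _ _ (x, t)).
    - apply: measurable_funTS.
      exact: (@measurable_heat_potential_integrand _ _ _ _ (x, t)).
    - exact: measurable_funTS.
    - move=> w wt; rewrite lee_fin /h mulrCA ler_wpM2l ?heat_kernel_ge0//.
      have [/fneg ->|w0] := leP (w.2 : R) 0; first by rewrite mulr_ge0.
      rewrite /I indicE mem_set ?mulr1; first exact: fM.
      by rewrite /= in_itv/= w0.
  apply: ge0_subset_integral => //; exact: measurable_before.
rewrite /lebesgue_spacetime fubini_tonelli2// /fubini_G.
have -> : (\int[lebesgue_measure]_s \int[lebesgue_rvec R n]_y (h (y, s))%:E =
    \int[lebesgue_measure]_s ((M / Gamma a)%:E *
      (((t - s) `^ (a - 1))%:E * (I s)%:E)))%E.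
  apply: eq_integral => s _; rewrite /h/=.
  have [st|st] := boolP (s \in `]0, t[); last first.
    rewrite /I indicE memNset ?mule0; last exact/negP.
    by rewrite integral0_eq// => y _; rewrite !mulr0.
  rewrite /I indicE mem_set// mule1.
  under eq_integral do rewrite mulr1 EFinM.
  move: st; rewrite in_itv/= => /andP[s0 st].
  rewrite ge0_integralZl_EFin//.
  - by rewrite integral_heat_kernel ?subr_gt0// -!EFinM; congr EFin; ring.
  - by move=> y _; rewrite lee_fin heat_kernel_ge0.
  - apply/measurable_EFinP.
    exact: (measurableT_comp (@measurable_heat_kernel R n a t x)
      (pair2_measurable s)).
have mp : measurable_fun setT (fun s : R => (((t - s) `^ (a - 1))%:E)).
  apply/measurable_EFinP.
  apply: (@measurableT_comp _ _ _ _ _ _ (fun s : R => s `^ (a - 1))).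
    exact: measurable_powR.
  exact: measurable_funB.
rewrite ge0_integralZl_EFin//; last 3 first.
- by move=> s _; rewrite mule_ge0// lee_fin ?powR_ge0.
- by apply: emeasurable_funM => //; exact/measurable_EFinP.
- by rewrite divr_ge0// ltW// Gamma_gt0.
have -> : (\int[lebesgue_measure]_s (((t - s) `^ (a - 1))%:E * (I s)%:E) =
    \int[lebesgue_measure]_(s in `]0%R, t[) ((t - s) `^ (a - 1))%:E)%E.
  by rewrite [RHS]integral_mkcond epatch_indic.
apply: (@le_lt_trans _ _ ((M / Gamma a)%:E * (t `^ a / a)%:E)%E).
  by rewrite lee_wpmul2l ?integral_powR_end_le// lee_fin divr_ge0// ltW// Gamma_gt0.
by rewrite -EFinM ltry.
Qed.

(** * Lower bound on the paraboloid *)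

(** When s is comparable to t and |y|^2 is at most a multiple of t, the
kernel is at least a constant times its value at y = 0, s = t, which is a
multiple of t^(a - 1 - n/2). *)
Lemma heat_kernel_parabolic_ge (R : realType) (n : nat) (a t s : R)
    (y : rvec R n) :
  0 < a -> 0 < t -> t / 4 <= s <= t / 2 -> sqnorm y <= 4 * t ->
  4^-1 `^ a * expR (- 4) / Gamma a *
    (t `^ (a - 1) / (4 * pi * t) `^ (n%:R / 2)) <= heat_kernel a y s.
Proof.
move=> a0 t0 /andP[ts st] yt.
have s0 : 0 < s by apply: lt_le_trans ts; rewrite divr_gt0.
rewrite /heat_kernel indicE mem_set ?mulr1; last by rewrite /= in_itv/= s0.
have -> : 4^-1 `^ a * expR (- 4) / Gamma a *
    (t `^ (a - 1) / (4 * pi * t) `^ (n%:R / 2)) =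
    4^-1 `^ a * t `^ (a - 1) / Gamma a * ((4 * pi * t) `^ (n%:R / 2))^-1 *
    expR (- 4).
  set A := powR _ _; set B := powR _ _; set C := _^-1.
  by ring.
have p4 r : 0 < r -> 0 < 4 * pi * r :> R.
  by move=> r0; rewrite !mulr_gt0// pi_gt0.
have G0 := Gamma_gt0 a0.
apply: ler_pM.
- by rewrite !mulr_ge0 ?powR_ge0 ?invr_ge0 ?powR_ge0// ltW.
- exact: expR_ge0.
- apply: ler_pM.
  + by rewrite !mulr_ge0 ?powR_ge0 ?invr_ge0// ltW.
  + by rewrite invr_ge0 powR_ge0.
  + rewrite ler_pM2r ?invr_gt0//.
    have -> : s `^ (a - 1) = (s / t) `^ (a - 1) * t `^ (a - 1).
      rewrite -powRM ?(ltW t0) ?divr_ge0 ?(ltW s0)//; last exact: ltW.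
      by rewrite divfK// gt_eqF.
    rewrite ler_wpM2r ?powR_ge0//.
    (* s / t lies in [1/4, 1/2], so (s / t)^(a - 1) >= (s / t)^a >= 4^(- a)
       whatever the sign of a - 1. *)
    apply: (@le_trans _ _ ((s / t) `^ a)).
      rewrite ge0_ler_powR ?nnegrE ?invr_ge0 ?(ltW a0) ?divr_ge0 ?(ltW s0) ?(ltW t0)//.
      by rewrite ler_pdivlMr// mulrC.
    apply: ger_powR; last by rewrite gerBl.
    rewrite divr_gt0//= ler_pdivrMr// mul1r (le_trans st)//.
    by lra.
  + rewrite lef_pV2 ?posrE ?powR_gt0 ?p4//.
    rewrite ge0_ler_powR ?nnegrE ?divr_ge0 ?(ltW (p4 _ _))//.
    rewrite ler_pM2l ?mulr_gt0 ?pi_gt0// (le_trans st)//.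
    by lra.
- rewrite ler_expR mulNr lerN2 ler_pdivrMr ?mulr_gt0// (le_trans yt)//.
  by rewrite ler_pM2l//; lra.
Qed.

Lemma sqnorm_cube_le (R : realType) (n : nat) (l : R) (y : rvec R n) :
  (forall i, 0 <= (tnth y i : R) <= l) -> sqnorm y <= n%:R * l ^+ 2.
Proof.
move=> yl; rewrite /sqnorm.
apply: (@le_trans _ _ (\sum_(i < n) l ^+ 2)); last first.
  by rewrite sumr_const card_ord mulr_natl.
apply: ler_sum => i _; have /andP[y0 {}yl] := yl i.
by rewrite ler_pXn2r ?nnegrE// (le_trans y0).
Qed.

(** The scaling estimate behind the theorem.  For (x, t) in Omega, the box
[0, l]^n * [t / 2, 3 t / 4] with l^2 = t / (4 n) lies in Omega, and on it the
kernel with pole (x, t) is at least a constant times t^(a - 1 - n/2).  The box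
has volume proportional to t^(n/2 + 1), so a source that is at least m there
produces a potential at least K t^a m, with K independent of t and x. *)
Lemma heat_potential_parabolic_ge (R : realType) (n : nat) (a : R) :
  (0 < n)%N -> 0 < a ->
  exists2 K : R, 0 < K &
  forall (f : spacetime R n -> R) (z : spacetime R n) (m : R),
    measurable_fun setT f -> (forall w, 0 <= f w) -> 0 <= m -> Omega z ->
    (forall w, Omega w -> (z.2 : R) / 2 <= w.2 -> m <= f w) ->
    ((K * (z.2 : R) `^ a * m)%:E <= heat_potential a f z)%E.
Proof.
move=> n0 a0; have G0 := Gamma_gt0 a0.
have n0R : 0 < n%:R :> R by rewrite ltr0n.
have pn0 : 0 < (16 * pi * n%:R)^-1 :> R by rewrite invr_gt0 !mulr_gt0 ?pi_gt0.
(* The last two factors are the volume l^n (t / 4) of the box, divided by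
   t (4 pi t)^(n/2). *)
exists (4^-1 `^ a * expR (- 4) / Gamma a *
    (16 * pi * n%:R)^-1 `^ (n%:R / 2) / 4).
  by rewrite divr_gt0// mulr_gt0 ?(powR_gt0 _ pn0)// divr_gt0// mulr_gt0 ?expR_gt0.
move=> f [x t] m mf f0 m0; rewrite /Omega/= => xt fm.
have t0 : 0 < t := le_lt_trans (sqnorm_ge0 x) xt.
pose l := Num.sqrt (t / (4 * n%:R)).
have tn0 : 0 < t / (4 * n%:R) by rewrite divr_gt0 ?mulr_gt0.
pose k := 4^-1 `^ a * expR (- 4) / Gamma a *
    (t `^ (a - 1) / (4 * pi * t) `^ (n%:R / 2)).
have k0 : 0 <= k.
  by rewrite !mulr_ge0 ?invr_ge0 ?powR_ge0 ?expR_ge0 ?invr_ge0 ?powR_ge0// ltW.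
have -> : 4^-1 `^ a * expR (- 4) / Gamma a *
    (16 * pi * n%:R)^-1 `^ (n%:R / 2) / 4 * t `^ a * m =
    m * k * ((l - 0) ^+ n * (3 * t / 4 - t / 2)).
  have p4t : 0 < 4 * pi * t by rewrite !mulr_gt0 ?pi_gt0.
  have -> : (l - 0) ^+ n =
      (4 * pi * t) `^ (n%:R / 2) * (16 * pi * n%:R)^-1 `^ (n%:R / 2).
    rewrite -powRM ?(ltW p4t) ?(ltW pn0)// subr0.
    have -> : 4 * pi * t * (16 * pi * n%:R)^-1 = t / (4 * n%:R).
      have := pi_gt0 R; move: pi => q q0.
      by field; rewrite !gt_eqF.
    by rewrite [n%:R / 2]mulrC powRrM powR12_sqrt ?powR_mulrn ?sqrtr_ge0// ltW.
  have -> : t `^ a = t * t `^ (a - 1) by rewrite mulr_powRB1// ltW.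
  rewrite /k; have := powR_gt0 (n%:R / 2) p4t.
  set P := _ `^ (n%:R / 2) => P0.
  set Q := _ `^ (n%:R / 2); set S := _ `^ (a - 1); set U := _ `^ a.
  by field; rewrite !gt_eqF.
have ts : t / 2 <= 3 * t / 4 by move: t0; clear; move: t => /= t t0; lra.
have mk0 : 0 <= m * k by rewrite mulr_ge0.
rewrite -integral_spacetime_box ?sqrtr_ge0//.
rewrite /heat_potential [leRHS]integral_mkcond.
apply: ge0_le_integral => //.
- by move=> w _; rewrite lee_fin mulr_ge0 ?spacetime_box_ge0.
- apply/measurable_EFinP; apply: measurable_funM => //.
  exact: measurable_spacetime_box.
- apply/(measurable_restrictT _ _).1; first exact: measurable_before.
  apply: measurable_funTS.
  exact: (@measurable_heat_potential_integrand _ _ _ _ (x, t)).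
move=> w _; have [[ybox /andP[tw wt]]|out] := pselect
    ((forall i, 0 <= (tnth w.1 i : R) <= l) /\
     t / 2 <= (w.2 : R) <= 3 * t / 4); last first.
  rewrite spacetime_box_out// mulr0; apply: erestrict_ge0 => w' _.
  exact: (@heat_potential_integrand_ge0 _ _ _ _ (x, t)).
rewrite spacetime_box_in ?tw// mulr1.
have wb : before t w by rewrite /before/=; lra.
rewrite patchE mem_set//= lee_fin mulrC.
have yt : sqnorm w.1 <= t / 4.
  apply: le_trans (sqnorm_cube_le ybox) _.
  rewrite sqr_sqrtr ?(ltW tn0)//.
  by have -> : n%:R * (t / (4 * n%:R)) = t / 4 by field; rewrite gt_eqF.
apply: ler_pM => //.
  apply: heat_kernel_parabolic_ge => //.
    by apply/andP; split; lra.
  (* |x - y|^2 <= 2 (t + t / 4) *)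
  by apply: le_trans (sqnorm_sub_le _ _) _; lra.
by apply: fm => //=; rewrite /Omega/=; lra.
Qed.

(** * The self-similar source *)

(** Before time T, Omega is contained in a bounded box, so local boundedness
in time is enough for p-integrability. *)
Lemma Xspace_supported_Omega (R : realType) (n : nat) (p : R)
    (f : spacetime R n -> R) :
  0 < p -> measurable_fun setT f -> (forall w, 0 <= f w) ->
  (forall w, ~ Omega w -> f w = 0) ->
  (forall T : R, exists M : R, forall w, before T w -> f w <= M) ->
  Xspace p f.
Proof.
move=> p0 mf f0 fO fM; split => // T; have [M {}fM] := fM T.
apply: (lty_poweRy (lt0r_neq0 p0)); rewrite poweR_Lnorm ?gt_eqF//.
have -> : (\int[lebesgue_spacetime]_w `|(EFin \o f \_ (before T)) w| `^ p =
    \int[lebesgue_spacetime]_w ((f \_ (before T)) w `^ p)%:E)%E.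
  apply: eq_integral => w _ /=; rewrite ger0_norm ?poweR_EFin//.
  by apply: restrict_ge0 => *; exact: f0.
pose l := Num.sqrt `|T|; have l0 : 0 <= l := sqrtr_ge0 _.
have ll : - l <= l by lra.
apply: (@le_lt_trans _ _ (\int[lebesgue_spacetime]_w
    (M `^ p * @spacetime_box R n (- l) l 0 `|T| w)%:E)%E); last first.
  by rewrite integral_spacetime_box ?powR_ge0// ltry.
apply: ge0_le_integral => //.
- by move=> w _; rewrite lee_fin powR_ge0.
- apply/measurable_EFinP.
  apply: (@measurableT_comp _ _ _ _ _ _ (fun s : R => s `^ p)).
    exact: measurable_powR.
  apply/(measurable_restrictT _ _).1; first exact: measurable_before.
  exact: measurable_funTS.
- apply/measurable_EFinP; apply: measurable_funM => //.
  exact: measurable_spacetime_box.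
move=> w _; rewrite lee_fin.
have rhs0 : 0 <= M `^ p * spacetime_box (- l) l 0 `|T| w.
  by rewrite mulr_ge0 ?powR_ge0 ?spacetime_box_ge0.
rewrite patchE; case: ifPn => [|_]; last by rewrite powR0 ?gt_eqF.
rewrite inE => wT; have [Ow|/fO ->] := pselect (Omega w); last first.
  by rewrite powR0 ?gt_eqF.
have w0 : 0 <= (w.2 : R) by apply: le_trans (ltW Ow); exact: sqnorm_ge0.
have wT' : (w.2 : R) <= `|T| by apply: le_trans (ltW wT) (ler_norm T).
rewrite spacetime_box_in ?w0//.
  rewrite mulr1 ge0_ler_powR ?nnegrE ?(ltW p0) ?f0//; last exact: fM.
  exact: le_trans (f0 w) (fM w wT).
move=> i; rewrite -ler_norml -sqrtr_sqr ler_wsqrtr//.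
apply: le_trans wT'; apply: le_trans (ltW Ow).
rewrite /sqnorm (bigD1 i)//= lerDl.
by apply: sumr_ge0 => j _; exact: sqr_ge0.
Qed.

Lemma power_profile_le (R : realType) (N a g s t : R) :
  0 <= N -> 0 <= a -> 0 <= g -> 0 <= s -> s <= t ->
  (N * s `^ a) `^ g <= (N * t `^ a) `^ g.
Proof.
move=> N0 a0 g0 s0 st; have t0 := le_trans s0 st.
rewrite ge0_ler_powR ?nnegrE ?mulr_ge0 ?powR_ge0//.
by rewrite ler_wpM2l// ge0_ler_powR ?nnegrE.
Qed.

(** The value of N for which the lower bound K t^a m, with m the profile at
time t / 2, reproduces the profile one power higher. *)
Lemma power_profile_half (R : realType) (K N a g t : R) :
  0 < N -> N = K * (2^-1 `^ a) `^ g -> 0 < t ->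
  (N * t `^ a) `^ (1 + g) = K * t `^ a * (N * (t / 2) `^ a) `^ g.
Proof.
move=> N0 NE t0; have Nt : 0 < N * t `^ a by rewrite mulr_gt0// powR_gt0.
rewrite powRD; last by rewrite (gt_eqF Nt) implybT.
rewrite (powRr1 (ltW Nt)).
have -> : N * (t / 2) `^ a = 2^-1 `^ a * (N * t `^ a).
  by rewrite powRM ?(ltW t0) ?invr_ge0//; ring.
rewrite (powRM _ (powR_ge0 _ _) (ltW Nt)) {1}NE; ring.
Qed.

Unset Implicit Arguments.

Theorem theorem3p4 (R : realType) (n : nat) (p alpha lambda : R)
    (n_ge1 : (1 <= n)%N)
    (p_alpha : (1 < p /\ 0 < alpha /\ alpha < (n%:R + 2) / (2 * p)) \/
               (p = 1 /\ 0 < alpha /\ alpha <= (n%:R + 2) / (2 * p)))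
    (lambda_gt0 : 0 < lambda) (lambda_lt1 : lambda < 1) :
  exists (N : R) (u Hu : spacetime R n -> R),
    0 < N /\ Yspace p alpha u /\ frac_heat p alpha u Hu /\
    {ae lebesgue_spacetime, forall z, 0 <= Hu z /\ Hu z <= u z `^ lambda} /\
    {ae lebesgue_spacetime, forall z, (z.2 : R) < 0 -> u z = 0} /\
    {ae lebesgue_spacetime, forall z, Omega z ->
      (N * (z.2 : R) `^ alpha) `^ (1 / (1 - lambda)) <= u z} /\
    {ae lebesgue_spacetime, forall z, Omega z ->
      (N * (z.2 : R) `^ alpha) `^ (lambda / (1 - lambda)) <= Hu z}.
Proof.
have p0 : 0 < p by case: p_alpha => -[]; lra.
have a0 : 0 < alpha by case: p_alpha => -[_ []].
have l1 : 0 < 1 - lambda by rewrite subr_gt0.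
pose g := lambda / (1 - lambda); have g0 : 0 < g by rewrite divr_gt0.
have [K K0 KP] := @heat_potential_parabolic_ge R n alpha n_ge1 a0.
have [N N0 NE] : exists2 N, 0 < N & N = K * (2^-1 `^ alpha) `^ g.
  by exists (K * (2^-1 `^ alpha) `^ g); rewrite // mulr_gt0// !powR_gt0// invr_gt0.
pose prof (t : R) := (N * t `^ alpha) `^ g.
have prof_ge0 t : 0 <= prof t by exact: powR_ge0.
have prof_le s t : 0 <= s -> s <= t -> prof s <= prof t.
  by apply: power_profile_le; exact: ltW.
pose f (w : spacetime R n) := prof w.2 * \1_Omega w.
have f_ge0 w : 0 <= f w by rewrite mulr_ge0// indicE.
have f_in w : Omega w -> f w = prof w.2.
  by move=> Ow; rewrite /f indicE mem_set ?mulr1.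
have f_out w : ~ Omega w -> f w = 0.
  by move=> Ow; rewrite /f indicE memNset ?mulr0.
have Omega_gt0 w : @Omega R n w -> 0 < (w.2 : R).
  by apply: le_lt_trans; exact: sqnorm_ge0.
have f_neg w : (w.2 : R) <= 0 -> f w = 0.
  by move=> w0; apply: f_out => /Omega_gt0; rewrite ltNge w0.
have f_bnd T w : before T w -> f w <= prof T.
  move=> wT; have [Ow|/f_out ->//] := pselect (Omega w).
  by rewrite (f_in w Ow); apply: prof_le (ltW (Omega_gt0 w Ow)) (ltW wT).
have mf : measurable_fun setT f.
  have mpow b : measurable_fun setT (fun s : R => s `^ b).
    exact: measurable_powR.
  rewrite /f; apply: measurable_funM; last first.
    by apply: measurable_indic; exact: measurable_Omega.
  apply: (@measurableT_comp _ _ _ _ _ _ prof); last exact: measurable_snd.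
  apply: (@measurableT_comp _ _ _ _ _ _ (fun s : R => s `^ g)) => //.
  exact: measurable_funM.
have Jfin z := heat_potential_fin_num a0 mf f_ge0 f_neg (f_bnd z.2).
pose u z := fine (heat_potential alpha f z).
have uE z : (u z)%:E = heat_potential alpha f z by rewrite /u fineK.
have u_ge0 z : 0 <= u z.
  by rewrite fine_ge0// integral_ge0// => w _; exact: heat_potential_integrand_ge0.
have eg : 1 / (1 - lambda) = 1 + g by rewrite /g; field; rewrite gt_eqF.
have uOmega z : Omega z -> (N * (z.2 : R) `^ alpha) `^ (1 / (1 - lambda)) <= u z.
  move=> Oz; have z0 := Omega_gt0 _ Oz.
  have h0 : 0 <= (z.2 : R) / 2 by rewrite divr_ge0 ?ltW.
  rewrite -lee_fin uE eg (power_profile_half N0 NE z0).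
  apply: (KP f z (prof (z.2 / 2)) mf f_ge0 (prof_ge0 _) Oz).
  by move=> w Ow zw; rewrite (f_in w Ow); exact: prof_le.
have fX : Xspace p f.
  by apply: Xspace_supported_Omega => // T; exists (prof T); exact: f_bnd.
have ae_all (P : spacetime R n -> Prop) : (forall z, P z) ->
    {ae lebesgue_spacetime, forall z, P z}.
  by move=> PT; apply: aeW.
exists N, u, f; do !split=> //.
- by exists f; split => //; exact: ae_all.
- exact: ae_all.
- apply: ae_all => z; split => //.
  have [Oz|/f_out ->] := pselect (Omega z); last exact: powR_ge0.
  rewrite f_in// /prof.
  (* Inside Omega the source is the power lambda of the lower bound for u. *)
  have -> : g = 1 / (1 - lambda) * lambda by rewrite /g; field; rewrite gt_eqF.
  by rewrite powRrM ge0_ler_powR ?nnegrE ?powR_ge0 ?(ltW lambda_gt0)// uOmega.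
- apply: ae_all => z z0; rewrite /u heat_potential_eq0// => w wz.
  by apply: f_neg; apply: ltW; exact: lt_trans wz z0.
- exact: ae_all.
- by apply: ae_all => z Oz; rewrite f_in.
Qed.
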